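(* Let $M$ be a monoid and suppose that the simplicial set $BM$ admits a collapsing scheme $(E,C,R,c,i)$, with set of essential $n$-cells $E_n$. (a) If $(E,C,R,c,i)$ is left guarded, then there is an $M$-equivariant collapsing scheme $(\mathfrak E,\mathfrak R,\mathfrak C,\kappa,\iota)$ for the free left $M$-simplicial set $\overrightarrow{EM}$ such that, for each $n$, the set of essential $n$-cells $\mathfrak E_n$ is a free left $M$-set of rank $|E_n|$. (b) If $(E,C,R,c,i)$ is right guarded, then there is an $M$-equivariant collapsing scheme $(\mathfrak E,\mathfrak R,\mathfrak C,\kappa,\iota)$ for the free right $M$-simplicial set $\overleftarrow{EM}$ such that, for each $n$, the set of essential $n$-cells $\mathfrak E_n$ is a free right $M$-set of rank $|E_n|$. (c) If $(E,C,R,c,i)$ is guarded, then there is an $M$-equivariant collapsing scheme $(\mathfrak E,\mathfrak R,\mathfrak C,\kappa,\iota)$ for the free bi-$M$-simplicial set $\overleftrightarrow{EM}$ such that, for each $n$, the set of essential $n$-cells $\mathfrak E_n$ is a free $M\times M^{op}$-set of rank $|E_n|$.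
   Context: Simplicial sets attached to $M$. $BM$ has as $n$-simplices the $n$-tuples $(m_1,\dots,m_n)$ of elements of $M$, with faces $d_0=(m_2,\dots,m_n)$, $d_j=(m_1,\dots,m_jm_{j+1},\dots,m_n)$ for $0<j<n$, $d_n=(m_1,\dots,m_{n-1})$, and degeneracies inserting $1$: $s_j=(m_1,\dots,m_j,1,m_{j+1},\dots,m_n)$. $\overrightarrow{EM}$ (nerve of the right Cayley graph category) has $n$-simplices $m(m_1,\dots,m_n)$ with $m,m_j\in M$, faces $d_0=mm_1(m_2,\dots,m_n)$, $d_j=m(m_1,\dots,m_jm_{j+1},\dots,m_n)$ for $0<j<n$, $d_n=m(m_1,\dots,m_{n-1})$, degeneracies inserting $1$ in the tuple, and left action $s\cdot m(m_1,\dots,m_n)=sm(m_1,\dots,m_n)$. $\overleftarrow{EM}$ is defined dually (nerve of the left Cayley graph category): $n$-simplices $(m_1,\dots,m_n)m$, faces $d_0=(m_2,\dots,m_n)m$, $d_j=(m_1,\dots,m_jm_{j+1},\dots,m_n)m$ for $0<j<n$, $d_n=(m_1,\dots,m_{n-1})m_nm$, degeneracies inserting $1$, with $M$ acting on the right by right multiplication on $m$. $\overleftrightarrow{EM}$ (nerve of the two-sided Cayley graph category) has $n$-simplices $m(m_1,\dots,m_n)s$, faces $d_0=mm_1(m_2,\dots,m_n)s$, $d_j=m(m_1,\dots,m_jm_{j+1},\dots,m_n)s$ for $0<j<n$, $d_n=m(m_1,\dots,m_{n-1})m_ns$, degeneracies inserting $1$, and two-sided action $x\cdot m(m_1,\dots,m_n)s\cdot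 y=xm(m_1,\dots,m_n)sy$. Collapsing schemes. For a simplicial set $K$, an $n$-cell is a non-degenerate $n$-simplex. A collapsing scheme for $K$, with data $E,C,R,c,i$, consists of a partition of the cells into essential ($E$), collapsible ($C$) and redundant ($R$) cells, all collapsible cells having dimension at least one, together with maps $c,i$ assigning to each redundant $n$-cell $\tau$ a collapsible $(n+1)$-cell $c(\tau)$ and a number $i(\tau)\in\{0,\dots,n+1\}$ with $\tau=d_{i(\tau)}(c(\tau))$. For redundant $n$-cells write $\tau'\prec\tau$ if $\tau'=d_j(c(\tau))$ for some $j\ne i(\tau)$. It is required that (C1) for all $n$, $c$ is a bijection $R_n\to C_{n+1}$ (subscripts denote the cells of that dimension); (C2) there is no infinite descending chain $\tau\succ\tau'\succ\cdots$ of redundant $n$-cells. The height of a redundant cell $\tau$ is the maximum $k$ in a chain $\tau=\tau_0\succ\tau_1\succ\cdots\succ\tau_k$. The scheme is left guarded if $i(\tau)\ne0$ for every redundant $n$-cell $\tau$ (all $n$); right guarded if $i(\tau)\ne n+1$ for every redundant $n$-cell $\tau$ (all $n$); guarded if both. $M$-equivariant collapsing schemes. A rigid left $M$-simplicial set is a simplicial set with a left $M$-action by simplicial morphisms preserving non-degeneracy of simplices; it is free if the $n$-cells form a free left $M$-set for each $n$. A collapsing scheme $(E,R,C,c,i)$ for a rigid free left $M$-simplicial set $K$ is $M$-equivariant if: (A1) $M$ acts by simplicial morphisms. (A2) For every simplex $\sigma$ and $m\in M$, $\sigma$ is a cell iff $m\sigma$ is a cell, in which case $\sigma\in E$ (resp.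 $R$, $C$) iff $m\sigma\in E$ (resp. $R$, $C$). (A3) $c(m\sigma)=mc(\sigma)$ for all redundant $\sigma$ and $m\in M$. (A4) There is a subset $B\subseteq E\cup R\cup C$ such that for all $n$ the set of $n$-cells is a free left $M$-set with basis the $n$-cells in $B$; putting $E^B=E\cap B$, $R^B=R\cap B$, $C^B=C\cap B$, $E_n$ is a free left $M$-set with basis $E^B_n$, and similarly for $R_n$, $C_n$. (A5) For every redundant $\sigma$, $\sigma\in R^B$ iff $c(\sigma)\in C^B$. (A6) $\mathrm{height}(\tau)=\mathrm{height}(m\tau)$ for every redundant $\tau$ and $m\in M$. For a rigid free right $M$-simplicial set (resp. bi-$M$-simplicial set) $K$, a collapsing scheme is called $M$-equivariant if these axioms hold for $K$ viewed as a left $M^{op}$-simplicial set (resp. left $M\times M^{op}$-simplicial set). *)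

(* Defs.v *)
From HB Require Import structures.
From mathcomp Require Import all_boot zify.
From mathcomp Require Import boolp classical_sets functions cardinality.

Set Implicit Arguments.
Unset Strict Implicit.
Unset Printing Implicit Defensive.

Local Open Scope classical_set_scope.

(* The product monoid used for two-sided actions is the library's instance on
   pairs. *)
Definition opp_monoid (M : Type) : Type := M.

Section OppMonoid.
Variable M : monoidType.
HB.instance Definition _ := Choice.on (opp_monoid M).
Let mul (x y : opp_monoid M) : opp_monoid M := ((y : M) * (x : M))%g.
Let mulA : associative mul. Proof. by move=> x y z; rewrite /mul mulgA. Qed.
Let mul1 : left_id (1%g : M) mul. Proof. by move=> x; rewrite /mul mulg1. Qed.
Let mulr1 : right_id (1%g : M) mul. Proof. by move=> x; rewrite /mul mul1g. Qed.
HB.instance Definition _ := isMonoid.Build (opp_monoid M) mulA mul1 mulr1.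
End OppMonoid.

Record sset := SSet {
  simplex :> nat -> Type;
  face : forall n, 'I_n.+2 -> simplex n.+1 -> simplex n;
  degen : forall n, 'I_n.+1 -> simplex n -> simplex n.+1;
  face_face : forall n (x : simplex n.+2) i j, i < j <= n.+2 ->
    face (inord i) (face (inord j) x) = face (inord j.-1) (face (inord i) x);
  degen_degen : forall n (x : simplex n) i j, i <= j <= n ->
    degen (inord i) (degen (inord j) x) = degen (inord j.+1) (degen (inord i) x);
  face_degen_lt : forall n (x : simplex n.+1) i j, i < j <= n.+1 ->
    face (inord i) (degen (inord j) x) = degen (inord j.-1) (face (inord i) x);
  face_degen_id : forall n (x : simplex n) j, j <= n ->
    face (inord j) (degen (inord j) x) = x;
  face_degen_succ : forall n (x : simplex n) j, j <= n ->
    face (inord j.+1) (degen (inord j) x) = x;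
  face_degen_gt : forall n (x : simplex n.+1) i j, j.+1 < i <= n.+2 ->
    face (inord i) (degen (inord j) x) = degen (inord j) (face (inord i.-1) x)
}.

Arguments face {s n} i x.
Arguments degen {s n} i x.

Definition degenerate (K : sset) n : set (K n) :=
  match n with
  | 0 => set0
  | k.+1 => [set x | exists i y, x = degen i y]
  end.

Definition cells (K : sset) n : set (K n) := ~` @degenerate K n.
Arguments cells : clear implicits.

(* Only the values of [cmap] and [imap] on redundant cells are meaningful. *)
Record scheme_data (K : sset) := SchemeData {
  ess : forall n, set (K n);
  col : forall n, set (K n);
  red : forall n, set (K n);
  cmap : forall n, K n -> K n.+1;
  imap : forall n, K n -> 'I_n.+2
}.

Arguments ess {K} s n.
Arguments col {K} s n.
Arguments red {K} s n.
Arguments cmap {K} s {n} x.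
Arguments imap {K} s {n} x.

Section SchemeDefs.
Variables (K : sset) (S : scheme_data K).

Definition prec n (t' t : K n) : Prop :=
  [/\ red S n t, red S n t' &
      exists2 j, j != imap S t & t' = face j (cmap S t)].

Definition has_chain n (t : K n) (k : nat) : Prop :=
  exists2 u : nat -> K n, u 0 = t & forall l, l < k -> prec (u l.+1) (u l).

(* The maximal length of a descending chain from a redundant cell; it is
   attained for every collapsing scheme, see [heightP]. *)
Definition height n (t : K n) : nat :=
  xget 0 [set k | has_chain t k /\ forall l, has_chain t l -> l <= k].

End SchemeDefs.

Record collapsing_scheme (K : sset) := CollapsingScheme {
  scheme_of :> scheme_data K;
  scheme_cover : forall n,
    ess scheme_of n `|` col scheme_of n `|` red scheme_of n = cells K n;
  scheme_ess_col : forall n, ess scheme_of n `&` col scheme_of n = set0;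
  scheme_ess_red : forall n, ess scheme_of n `&` red scheme_of n = set0;
  scheme_col_red : forall n, col scheme_of n `&` red scheme_of n = set0;
  scheme_col0 : col scheme_of 0 = set0;
  scheme_face : forall n (t : K n), red scheme_of n t ->
    t = face (imap scheme_of t) (cmap scheme_of t);
  scheme_bij : forall n,
    set_bij (red scheme_of n) (col scheme_of n.+1) (cmap scheme_of (n := n));
  scheme_wf : forall n, ~ exists u : nat -> K n,
    forall k, prec scheme_of (u k.+1) (u k)
}.

Definition left_guarded (K : sset) (S : scheme_data K) : Prop :=
  forall n (t : K n), red S n t -> imap S t <> ord0.

Definition right_guarded (K : sset) (S : scheme_data K) : Prop :=
  forall n (t : K n), red S n t -> imap S t <> ord_max.

Definition guarded (K : sset) (S : scheme_data K) : Prop :=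
  left_guarded S /\ right_guarded S.

Lemma has_chain0 (K : sset) (S : scheme_data K) n (t : K n) : has_chain S t 0.
Proof. by exists (fun=> t). Qed.

Lemma has_chainS (K : sset) (S : scheme_data K) n (t : K n) k :
  has_chain S t k.+1 -> exists2 t', prec S t' t & has_chain S t' k.
Proof.
case=> u u0 hu; exists (u 1); first by rewrite -u0; apply: hu.
by exists (fun l => u l.+1) => // l lk; apply: hu.
Qed.

(* The chains from a redundant cell have bounded length, since each redundant
   cell has finitely many predecessors for [prec] (Koenig's lemma). *)
Lemma has_chain_bounded (K : sset) (S : collapsing_scheme K) n (t : K n) :
  exists b, forall l, has_chain S t l -> l <= b.
Proof.
pose bounded (x : K n) := exists b, forall l, has_chain S x l -> l <= b.
apply: contrapT => nbt.
have step x : ~ bounded x -> exists y, prec S y x /\ ~ bounded y.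
  move=> nbx; apply: contrapT => nex; apply: nbx.
  have bnd y : prec S y x -> bounded y.
    by move=> yx; apply: contrapT => nby; apply: nex; exists y.
  have /choice[b hb] : forall j : 'I_n.+2, exists b,
      prec S (face j (cmap S x)) x ->
      forall l, has_chain S (face j (cmap S x)) l -> l <= b.
    move=> j; case: (pselect (prec S (face j (cmap S x)) x)) => [/bnd[b hb]|np].
      by exists b.
    by exists 0.
  exists (\max_j b j).+1 => -[//|l] /has_chainS[y yx cy].
  case: (yx) => _ _ [j _ yE]; rewrite yE in yx cy.
  by rewrite ltnS (leq_trans (hb j yx l cy)) // leq_bigmax.
have /choice[f hf] : forall x, exists y, ~ bounded x ->
    prec S y x /\ ~ bounded y.
  move=> x; case: (pselect (bounded x)) => [bx|/step[y hy]]; last by exists y.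
  by exists x.
have nb k : ~ bounded (iter k f t).
  by elim: k => [//|k IH] /=; case: (hf _ IH).
case: (@scheme_wf _ S n); exists (fun k => iter k f t) => k /=.
by case: (hf _ (nb k)).
Qed.

Lemma heightP (K : sset) (S : collapsing_scheme K) n (t : K n) :
  has_chain S t (height S t) /\
  forall l, has_chain S t l -> l <= height S t.
Proof.
rewrite /height; case: xgetP => [k _ []//|none]; exfalso.
have [b hb] := has_chain_bounded S t.
have exP : exists k, `[< has_chain S t k >].
  by exists 0; apply/asboolP/has_chain0.
have ubP k : `[< has_chain S t k >] -> k <= b by move/asboolP; apply: hb.
case: (ex_maxnP exP ubP) => k /asboolP ck maxk; apply: (none k).
by split=> // l cl; apply: maxk; apply/asboolP.
Qed.

Definition is_basis (M X : Type) (a : M -> X -> X) (A B : set X) : Prop :=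
  [/\ B `<=` A, (forall m x, A x -> A (a m x)) &
      forall x, A x -> exists! p : M * X, B p.2 /\ x = a p.1 p.2].

Definition free_of_rank (M X I : Type) (a : M -> X -> X) (A : set X)
    (r : set I) : Prop :=
  exists2 B, is_basis a A B & (B #= r)%card.

(* The last two fields express rigidity and freeness. *)
Record lsset (M : monoidType) := LSSet {
  lsset_sset :> sset;
  act : forall n, M -> lsset_sset n -> lsset_sset n;
  act_1 : forall n (x : lsset_sset n), act 1%g x = x;
  act_M : forall n m m' (x : lsset_sset n), act (m * m')%g x = act m (act m' x);
  act_face : forall n m (i : 'I_n.+2) (x : lsset_sset n.+1),
    act m (face i x) = face i (act m x);
  act_degen : forall n m (i : 'I_n.+1) (x : lsset_sset n),
    act m (degen i x) = degen i (act m x);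
  act_rigid : forall n m (x : lsset_sset n),
    cells lsset_sset n x -> cells lsset_sset n (act m x);
  act_free : forall n,
    exists B, is_basis (@act n) (cells lsset_sset n) B
}.

Arguments act {M l n} m x.

(* Rigid free right [M]-simplicial sets and bi-[M]-simplicial sets, as left
   simplicial sets over M^op and M x M^op. *)
Definition rsset (M : monoidType) := lsset (opp_monoid M).
Definition bisset (M : monoidType) := lsset (M * opp_monoid M)%type.

Record equivariant (M : monoidType) (K : lsset M) (S : collapsing_scheme K) :
    Prop := Equivariant {
  equivariant_A1 : forall n m,
    (forall i (x : K n.+1), act m (face i x) = face i (act m x)) /\
    (forall i (x : K n), act m (degen i x) = degen i (act m x));
  equivariant_A2 : forall n m (x : K n),
    (cells K n x <-> cells K n (act m x)) /\
    (cells K n x ->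
      [/\ ess S n x <-> ess S n (act m x),
          red S n x <-> red S n (act m x) &
          col S n x <-> col S n (act m x)]);
  equivariant_A3 : forall n m (x : K n), red S n x ->
    cmap S (act m x) = act m (cmap S x);
  equivariant_A45 : exists B : forall n, set (K n),
    (forall n,
      [/\ B n `<=` ess S n `|` red S n `|` col S n,
          is_basis act (cells K n) (B n),
          is_basis act (ess S n) (ess S n `&` B n),
          is_basis act (red S n) (red S n `&` B n) &
          is_basis act (col S n) (col S n `&` B n)]) /\
    (forall n (x : K n), red S n x ->
      (red S n `&` B n) x <-> (col S n.+1 `&` B n.+1) (cmap S x));
  equivariant_A6 : forall n m (x : K n), red S n x ->
    height S x = height S (act m x)
}.

(* The entries of a tuple are numbered from 0, so that [nth 1 t k] is the
   mathematical m_(k+1). *)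

Section Bar.
Variable M : monoidType.

(* For [j = 0] (resp. [j = n.+1]) no index satisfies one of the first two (resp.
   last two) conditions, and the first (resp. last) entry is dropped. *)
Definition bar_face n (j : 'I_n.+2) (t : n.+1.-tuple M) : n.-tuple M :=
  [tuple if k.+1 < j then nth 1%g t k
         else if k.+1 == j then (nth 1 t k * nth 1 t k.+1)%g
         else nth 1%g t k.+1 | k < n].

Definition bar_degen n (j : 'I_n.+1) (t : n.-tuple M) : n.+1.-tuple M :=
  [tuple if k < j then nth 1%g t k
         else if k == j :> nat then 1%g
         else nth 1%g t k.-1 | k < n.+1].

(* The part of a face that acts on the leading, resp. trailing, entry of a
   simplex m(m_1,...,m_n)s. *)
Definition lead_face n (j : 'I_n.+2) (m : M) (t : n.+1.-tuple M) : M :=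
  if j == ord0 then (m * tnth t ord0)%g else m.

Definition trail_face n (j : 'I_n.+2) (t : n.+1.-tuple M) (s : M) : M :=
  if j == ord_max then (tnth t ord_max * s)%g else s.

Lemma nth_bar_face n (j : 'I_n.+2) t k : k < n ->
  nth 1%g (bar_face j t) k =
    if k.+1 < j then nth 1%g t k
    else if k.+1 == j then (nth 1 t k * nth 1 t k.+1)%g
    else nth 1%g t k.+1.
Proof.
by move=> kn; rewrite -(tnth_nth _ _ (Ordinal kn)) tnth_mktuple.
Qed.

Lemma nth_bar_degen n (j : 'I_n.+1) t k : k < n.+1 ->
  nth 1%g (bar_degen j t) k =
    if k < j then nth 1%g t k
    else if k == j then 1%g
    else nth 1%g t k.-1.
Proof.
by move=> kn; rewrite -(tnth_nth _ _ (Ordinal kn)) tnth_mktuple.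
Qed.

Lemma lead_faceE n (j : 'I_n.+2) m t :
  lead_face j m t = if (j : nat) == 0 then (m * nth 1 t 0)%g else m.
Proof. by rewrite /lead_face -val_eqE /= (tnth_nth 1%g). Qed.

Lemma trail_faceE n (j : 'I_n.+2) t s :
  trail_face j t s = if (j : nat) == n.+1 then (nth 1 t n * s)%g else s.
Proof. by rewrite /trail_face -val_eqE /= (tnth_nth 1%g). Qed.

Lemma eq_nth_tuple n (t t' : n.-tuple M) :
  (forall k, k < n -> nth 1%g t k = nth 1%g t' k) -> t = t'.
Proof. by move=> e; apply: eq_from_tnth => k; rewrite !(tnth_nth 1%g); apply: e. Qed.

Ltac splits :=
  repeat first
    [ rewrite inordK; [|by lia]
    | rewrite nth_bar_face; [|by lia]
    | rewrite nth_bar_degen; [|by lia] | case: ifPn => ?; try (exfalso; lia) ];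
  rewrite ?(mulgA, mulg1, mul1g) //;
  by do ?congr (_ * _)%g; congr (nth _ _ _); lia.

Lemma bar_face_face n (t : n.+2.-tuple M) i j : i < j <= n.+2 ->
  bar_face (inord i) (bar_face (inord j) t) =
  bar_face (inord j.-1) (bar_face (inord i) t).
Proof.
by move=> ij; apply: eq_nth_tuple => k kn; splits.
Qed.

Lemma bar_degen_degen n (t : n.-tuple M) i j : i <= j <= n ->
  bar_degen (inord i) (bar_degen (inord j) t) =
  bar_degen (inord j.+1) (bar_degen (inord i) t).
Proof. by move=> ij; apply: eq_nth_tuple => k kn; splits. Qed.

Lemma bar_face_degen_lt n (t : n.+1.-tuple M) i j : i < j <= n.+1 ->
  bar_face (inord i) (bar_degen (inord j) t) =
  bar_degen (inord j.-1) (bar_face (inord i) t).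
Proof. by move=> ij; apply: eq_nth_tuple => k kn; splits. Qed.

Lemma bar_face_degen_id n (t : n.-tuple M) j : j <= n ->
  bar_face (inord j) (bar_degen (inord j) t) = t.
Proof. by move=> ij; apply: eq_nth_tuple => k kn; splits. Qed.

Lemma bar_face_degen_succ n (t : n.-tuple M) j : j <= n ->
  bar_face (inord j.+1) (bar_degen (inord j) t) = t.
Proof. by move=> ij; apply: eq_nth_tuple => k kn; splits. Qed.

Lemma bar_face_degen_gt n (t : n.+1.-tuple M) i j : j.+1 < i <= n.+2 ->
  bar_face (inord i) (bar_degen (inord j) t) =
  bar_degen (inord j) (bar_face (inord i.-1) t).
Proof. by move=> ij; apply: eq_nth_tuple => k kn; splits. Qed.

Lemma lead_face_face n m (t : n.+2.-tuple M) i j : i < j <= n.+2 ->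
  lead_face (inord i) (lead_face (inord j) m t) (bar_face (inord j) t) =
  lead_face (inord j.-1) (lead_face (inord i) m t) (bar_face (inord i) t).
Proof. by move=> ij; rewrite !lead_faceE; splits. Qed.

Lemma lead_face_degen_lt n m (t : n.+1.-tuple M) i j : i < j <= n.+1 ->
  lead_face (inord i) m (bar_degen (inord j) t) = lead_face (inord i) m t.
Proof. by move=> ij; rewrite !lead_faceE; splits. Qed.

Lemma lead_face_degen_id n m (t : n.-tuple M) j : j <= n ->
  lead_face (inord j) m (bar_degen (inord j) t) = m.
Proof. by move=> ij; rewrite !lead_faceE; splits. Qed.

Lemma lead_face_degen_succ n m (t : n.-tuple M) j : j <= n ->
  lead_face (inord j.+1) m (bar_degen (inord j) t) = m.
Proof. by move=> ij; rewrite !lead_faceE; splits. Qed.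

Lemma lead_face_degen_gt n m (t : n.+1.-tuple M) i j : j.+1 < i <= n.+2 ->
  lead_face (inord i) m (bar_degen (inord j) t) = lead_face (inord i.-1) m t.
Proof. by move=> ij; rewrite !lead_faceE; splits. Qed.

Lemma trail_face_face n (t : n.+2.-tuple M) s i j : i < j <= n.+2 ->
  trail_face (inord i) (bar_face (inord j) t) (trail_face (inord j) t s) =
  trail_face (inord j.-1) (bar_face (inord i) t) (trail_face (inord i) t s).
Proof. by move=> ij; rewrite !trail_faceE; splits. Qed.

Lemma trail_face_degen_lt n (t : n.+1.-tuple M) s i j : i < j <= n.+1 ->
  trail_face (inord i) (bar_degen (inord j) t) s = trail_face (inord i) t s.
Proof. by move=> ij; rewrite !trail_faceE; splits. Qed.

Lemma trail_face_degen_id n (t : n.-tuple M) s j : j <= n ->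
  trail_face (inord j) (bar_degen (inord j) t) s = s.
Proof. by move=> ij; rewrite !trail_faceE; splits. Qed.

Lemma trail_face_degen_succ n (t : n.-tuple M) s j : j <= n ->
  trail_face (inord j.+1) (bar_degen (inord j) t) s = s.
Proof. by move=> ij; rewrite !trail_faceE; splits. Qed.

Lemma trail_face_degen_gt n (t : n.+1.-tuple M) s i j : j.+1 < i <= n.+2 ->
  trail_face (inord i) (bar_degen (inord j) t) s = trail_face (inord i.-1) t s.
Proof. by move=> ij; rewrite !trail_faceE; splits. Qed.

Lemma lead_face_act n (j : 'I_n.+2) x m t :
  (x * lead_face j m t)%g = lead_face j (x * m)%g t.
Proof. by rewrite /lead_face; case: ifP; rewrite ?mulgA. Qed.

Lemma trail_face_act n (j : 'I_n.+2) t s y :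
  (trail_face j t s * y)%g = trail_face j t (s * y)%g.
Proof. by rewrite /trail_face; case: ifP; rewrite ?mulgA. Qed.

Definition BM : sset :=
  @SSet (fun n => n.-tuple M) bar_face bar_degen bar_face_face bar_degen_degen
    bar_face_degen_lt bar_face_degen_id bar_face_degen_succ bar_face_degen_gt.

(* [(m, t) : ER n] is m(m_1,...,m_n) in the nerve of the right Cayley graph. *)

Section Right.
Let simp n := (M * n.-tuple M)%type.

Definition ER_face n (j : 'I_n.+2) (x : simp n.+1) : simp n :=
  (lead_face j x.1 x.2, bar_face j x.2).
Definition ER_degen n (j : 'I_n.+1) (x : simp n) : simp n.+1 :=
  (x.1, bar_degen j x.2).
Definition ER_act n (a : M) (x : simp n) : simp n := ((a * x.1)%g, x.2).

Definition ER_sset : sset.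
Proof.
apply: (@SSet simp ER_face ER_degen) => n [m t]; rewrite /ER_face /ER_degen /=.
- by move=> i j ij; rewrite lead_face_face // bar_face_face.
- by move=> i j ij; rewrite bar_degen_degen.
- by move=> i j ij; rewrite lead_face_degen_lt // bar_face_degen_lt.
- by move=> j jn; rewrite lead_face_degen_id // bar_face_degen_id.
- by move=> j jn; rewrite lead_face_degen_succ // bar_face_degen_succ.
- by move=> i j ij; rewrite lead_face_degen_gt // bar_face_degen_gt.
Defined.

Lemma ER_degenerate n (x : ER_sset n) :
  degenerate x <-> degenerate (K := BM) x.2.
Proof.
case: n x => [//|n] [m t]; split=> [[i [[m' t'] [_ ->]]]|[i [t' /= ->]]].
  by exists i, t'.
by exists i, (m, t').
Qed.

Lemma ER_cells n (x : ER_sset n) : cells ER_sset n x <-> cells BM n x.2.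
Proof. by rewrite /cells /=; split=> h; rewrite /setC /= ER_degenerate in h *. Qed.

Lemma ER_free n :
  exists B, is_basis (@ER_act n) (cells ER_sset n) B.
Proof.
exists [set x | cells ER_sset n x /\ x.1 = 1%g]; split=> [x []//|a x|[m t]].
  by move/ER_cells=> h; apply/ER_cells.
move=> /ER_cells h; exists (m, (1%g, t)); split=> /=.
  by rewrite /ER_act /= mulg1; split=> //; split=> //; apply/ER_cells.
by case=> a [b u] /= [[_ ->]]; rewrite /ER_act /= mulg1 => -[-> ->].
Qed.

Definition ER : lsset M.
Proof.
apply: (@LSSet M ER_sset ER_act).
- by move=> n [m t]; rewrite /ER_act mul1g.
- by move=> n a b [m t]; rewrite /ER_act mulgA.
- by move=> n a i [m t]; rewrite /ER_act /= /ER_face lead_face_act.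
- by [].
- by move=> n a x /ER_cells h; apply/ER_cells.
- exact: ER_free.
Defined.
End Right.

(* [(t, m) : EL n] is (m_1,...,m_n)m in the nerve of the left Cayley graph. *)

Section Left.
Let simp n := (n.-tuple M * M)%type.

Definition EL_face n (j : 'I_n.+2) (x : simp n.+1) : simp n :=
  (bar_face j x.1, trail_face j x.1 x.2).
Definition EL_degen n (j : 'I_n.+1) (x : simp n) : simp n.+1 :=
  (bar_degen j x.1, x.2).
Definition EL_ract n (x : simp n) (b : M) : simp n := (x.1, (x.2 * b)%g).

Definition EL_sset : sset.
Proof.
apply: (@SSet simp EL_face EL_degen) => n [t s]; rewrite /EL_face /EL_degen /=.
- by move=> i j ij; rewrite trail_face_face // bar_face_face.
- by move=> i j ij; rewrite bar_degen_degen.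
- by move=> i j ij; rewrite trail_face_degen_lt // bar_face_degen_lt.
- by move=> j jn; rewrite trail_face_degen_id // bar_face_degen_id.
- by move=> j jn; rewrite trail_face_degen_succ // bar_face_degen_succ.
- by move=> i j ij; rewrite trail_face_degen_gt // bar_face_degen_gt.
Defined.

Lemma EL_degenerate n (x : EL_sset n) :
  degenerate x <-> degenerate (K := BM) x.1.
Proof.
case: n x => [//|n] [t s]; split=> [[i [[t' s'] [-> _]]]|[i [t' /= ->]]].
  by exists i, t'.
by exists i, (t', s).
Qed.

Lemma EL_cells n (x : EL_sset n) : cells EL_sset n x <-> cells BM n x.1.
Proof. by rewrite /cells /=; split=> h; rewrite /setC /= EL_degenerate in h *. Qed.

Definition EL_act n (b : opp_monoid M) (x : simp n) : simp n := EL_ract x b.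

Lemma EL_free n :
  exists B, is_basis (@EL_act n) (cells EL_sset n) B.
Proof.
exists [set x | cells EL_sset n x /\ x.2 = 1%g]; split=> [x []//|a x|[t s]].
  by move/EL_cells=> h; apply/EL_cells.
move=> /EL_cells h; exists (s, (t, 1%g)); split=> /=.
  by rewrite /EL_act /EL_ract /= mul1g; split=> //; split=> //; apply/EL_cells.
by case=> a [u b] /= [[_ ->]]; rewrite /EL_act /EL_ract /= mul1g => -[-> ->].
Qed.

Definition EL : rsset M.
Proof.
apply: (@LSSet (opp_monoid M) EL_sset EL_act).
- by move=> n [t s]; rewrite /EL_act /EL_ract mulg1.
- by move=> n a b [t s]; rewrite /EL_act /EL_ract mulgA.
- by move=> n a i [t s]; rewrite /EL_act /EL_ract /= /EL_face trail_face_act.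
- by [].
- by move=> n a x /EL_cells h; apply/EL_cells.
- exact: EL_free.
Defined.
End Left.

(* [(m, t, s) : ELR n] is m(m_1,...,m_n)s in the nerve of the two-sided Cayley
   graph. *)

Section TwoSided.
Let simp n := (M * n.-tuple M * M)%type.

Definition ELR_face n (j : 'I_n.+2) (x : simp n.+1) : simp n :=
  let: (m, t, s) := x in (lead_face j m t, bar_face j t, trail_face j t s).
Definition ELR_degen n (j : 'I_n.+1) (x : simp n) : simp n.+1 :=
  let: (m, t, s) := x in (m, bar_degen j t, s).
Definition ELR_biact n (a : M) (x : simp n) (b : M) : simp n :=
  let: (m, t, s) := x in ((a * m)%g, t, (s * b)%g).

Definition ELR_sset : sset.
Proof.
apply: (@SSet simp ELR_face ELR_degen) => n [[m t] s] /=.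
- move=> i j ij.
  by rewrite lead_face_face // trail_face_face // bar_face_face.
- by move=> i j ij; rewrite bar_degen_degen.
- move=> i j ij.
  by rewrite lead_face_degen_lt // trail_face_degen_lt // bar_face_degen_lt.
- move=> j jn.
  by rewrite lead_face_degen_id // trail_face_degen_id // bar_face_degen_id.
- move=> j jn; rewrite lead_face_degen_succ // trail_face_degen_succ //.
  by rewrite bar_face_degen_succ.
- move=> i j ij.
  by rewrite lead_face_degen_gt // trail_face_degen_gt // bar_face_degen_gt.
Defined.

Lemma ELR_degenerate n (x : ELR_sset n) :
  degenerate x <-> degenerate (K := BM) x.1.2.
Proof.
case: n x => [//|n] [[m t] s].
split=> [[i [[[m' t'] s'] [_ -> _]]]|[i [t' /= ->]]]; first by exists i, t'.
by exists i, (m, t', s).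
Qed.

Lemma ELR_cells n (x : ELR_sset n) : cells ELR_sset n x <-> cells BM n x.1.2.
Proof. by rewrite /cells /=; split=> h; rewrite /setC /= ELR_degenerate in h *. Qed.

Definition ELR_act n (ab : M * opp_monoid M) (x : simp n) : simp n :=
  ELR_biact ab.1 x ab.2.

Lemma ELR_free n :
  exists B, is_basis (@ELR_act n) (cells ELR_sset n) B.
Proof.
exists [set x | [/\ cells ELR_sset n x, x.1.1 = 1%g & x.2 = 1%g]].
split=> [x []//|a [[m t] s]|[[m t] s]].
  by move/ELR_cells=> h; apply/ELR_cells.
move=> /ELR_cells h; exists ((m, s), (1%g, t, 1%g)); split=> /=.
  rewrite /ELR_act /= mul1g mulg1; split=> //; split=> //.
  exact/ELR_cells.
case=> -[a b] [[m' u] s'] /= [[_ -> ->]].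
by rewrite /ELR_act /= mul1g mulg1 => -[-> -> ->].
Qed.

Definition ELR : bisset M.
Proof.
apply: (@LSSet (M * opp_monoid M)%type ELR_sset ELR_act).
- by move=> n [[m t] s]; rewrite /ELR_act /= mul1g mulg1.
- by move=> n [a b] [a' b'] [[m t] s]; rewrite /ELR_act /= !mulgA.
- move=> n [a b] i [[m t] s].
  by rewrite /ELR_act /= lead_face_act trail_face_act.
- by move=> n [a b] i [[m t] s].
- by move=> n [a b] [[m t] s] /ELR_cells h; apply/ELR_cells.
- exact: ELR_free.
Defined.
End TwoSided.
End Bar.

(* Main.v *)
Require Import Defs.
From mathcomp Require Import all_boot.
From mathcomp Require Import boolp classical_sets functions cardinality.

(** In degree [n], each of the three Cayley nerves is the product of the acting
    monoid [N] (which is [M], [M^op] or [M * M^op]) and the set of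
    [n]-simplices of [BM]: the action only moves the [N]-coordinate, and the
    projection to [BM] is simplicial and detects degeneracy.  So a collapsing
    scheme for [BM] pulls back along the projection, with the collapsible cell
    [c] of [(a, t)] taken to be [(a, c t)].  The one axiom that can fail is
    that [(a, t)] is the face of [(a, c t)] with number [i t], because an outer
    face may change the coordinate [a]: the face numbered 0 multiplies the left
    coordinate and the last face multiplies the right one.  Guardedness
    says precisely that [i] avoids the faces that do so ([lift_scheme]).

    Chains of redundant cells project to chains in [BM], and a chain in [BM]
    lifts to one with a prescribed start, the coordinates being dictated by the
    faces.  This yields the absence of infinite chains upstairs, and it shows
    that the height is that of the projection, hence is invariant under the
    action.  Finally, the cells with coordinate 1 are a basis of the preimage of
    any set of cells ([unit_section_basis]), and they project bijectively onto
    that set ([unit_section_card]), which gives the rank of the essential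
    cells. *)

Set Implicit Arguments.
Unset Strict Implicit.
Unset Printing Implicit Defensive.

Local Open Scope classical_set_scope.

(** A left [N]-simplicial set that is degreewise the product of [N] and a
    simplicial set [L], compatibly with the action and with the projection to
    [L].  Nothing ties the coordinate in [N] to the faces: this is the
    twisting. *)
Record twisted_product (N : monoidType) (K : lsset N) (L : sset) :=
  TwistedProduct {
    base : forall n, K n -> L n;
    coord : forall n, K n -> N;
    pair_at : forall n, N -> L n -> K n;
    pair_atK : forall n (x : K n), pair_at (coord x) (base x) = x;
    base_pair : forall n a (t : L n), base (pair_at a t) = t;
    coord_pair : forall n a (t : L n), coord (pair_at a t) = a;
    act_pair : forall n a b (t : L n),
      act b (pair_at a t) = pair_at (b * a)%g t;
    base_face : forall n j (x : K n.+1), base (face j x) = face j (base x);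
    base_cells : forall n (x : K n), cells K n x <-> cells L n (base x)
  }.

Arguments base {N K L} _ {n} _.
Arguments coord {N K L} _ {n} _.
Arguments pair_at {N K L} _ {n} _ _.

Lemma has_chain_cons (K : sset) (S : scheme_data K) n (t t' : K n) k :
  prec S t' t -> has_chain S t' k -> has_chain S t k.+1.
Proof.
move=> t't [u u0 hu]; exists (fun l => if l is l'.+1 then u l' else t) => //.
by case=> [|l] lk; [rewrite u0 | apply: hu].
Qed.

Section Lift.
Variables (N : monoidType) (K : lsset N) (L : sset).
Variables (P : twisted_product K L) (S : collapsing_scheme L).

Lemma twisted_product_inj n (x y : K n) :
  coord P x = coord P y -> base P x = base P y -> x = y.
Proof. by move=> e1 e2; rewrite -(pair_atK P x) e1 e2 pair_atK. Qed.

Lemma base_act n b (x : K n) : base P (act b x) = base P x.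
Proof. by rewrite -{1}(pair_atK P x) act_pair base_pair. Qed.

Lemma coord_act n b (x : K n) : coord P (act b x) = (b * coord P x)%g.
Proof. by rewrite -{1}(pair_atK P x) act_pair coord_pair. Qed.

Definition unit_section n (A : set (L n)) : set (K n) :=
  [set x | A (base P x) /\ coord P x = 1%g].

(** The pair [(a, t)] is [a] acting on [(1, t)], and in no other way a
    translate of a cell with coordinate 1. *)
Lemma unit_section_basis n (A : set (L n)) :
  is_basis act (base P (n := n) @^-1` A) (unit_section A).
Proof.
split=> [x []//|b x|x] /=; first by rewrite base_act.
move=> Ax; exists (coord P x, pair_at P 1%g (base P x)); split=> /=.
  split; first by rewrite /unit_section /= base_pair coord_pair.
  by rewrite act_pair mulg1 pair_atK.
case=> b y /= [[_ y1] ->].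
rewrite base_act coord_act y1 mulg1; congr (_, _).
by rewrite -y1 pair_atK.
Qed.

Lemma unit_section_card n (A : set (L n)) : (unit_section A #= A)%card.
Proof.
have im : base P (n := n) @` unit_section A = A.
  apply/seteqP; split=> [_ [x [Ax _] <-]//|t At].
  exists (pair_at P 1%g t); last by rewrite base_pair.
  by rewrite /unit_section /= base_pair coord_pair.
rewrite -{2}im; apply/card_esym/inj_card_eq => x y /set_mem[_ x1] /set_mem[_ y1].
by apply: twisted_product_inj; rewrite x1 y1.
Qed.

Definition lift_data : scheme_data K := @SchemeData K
  (fun n => base P (n := n) @^-1` ess S n)
  (fun n => base P (n := n) @^-1` col S n)
  (fun n => base P (n := n) @^-1` red S n)
  (fun n x => pair_at P (coord P x) (cmap S (base P x)))
  (fun n x => imap S (base P x)).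

Lemma base_prec n (x' x : K n) :
  prec lift_data x' x -> prec S (base P x') (base P x).
Proof.
case=> rx rx' [j ji e]; split=> //; exists j => //.
by rewrite e base_face base_pair.
Qed.

(** A step downstairs selects a face number, and the face of the lifted
    collapsible cell with that number is the lift of the step. *)
Lemma prec_lift n (x : K n) t' : prec S t' (base P x) ->
  exists2 x', prec lift_data x' x & base P x' = t'.
Proof.
case=> rt rt' [j ji e].
have be : base P (face j (cmap lift_data x)) = t' by rewrite base_face base_pair.
exists (face j (cmap lift_data x)) => //.
by split=> //; [rewrite /= be | exists j].
Qed.

Lemma has_chain_lift n (x : K n) k :
  has_chain lift_data x k <-> has_chain S (base P x) k.
Proof.
elim: k x => [|k IH] x; first by split=> _; exact: has_chain0.
split=> /has_chainS[y]; first by move=> /base_prec yx /IH; exact: has_chain_cons.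
by move=> /prec_lift[x' x'x <-] /IH; exact: has_chain_cons.
Qed.

(** Chains downstairs and upstairs have the same lengths, so the height
    forgets the coordinate, the only thing the action changes. *)
Lemma height_lift n (x : K n) : height lift_data x = height S (base P x).
Proof.
rewrite /height; congr xget; apply/seteqP.
by split=> k /= [/has_chain_lift ck maxk]; split=> // l /has_chain_lift;
  exact: maxk.
Qed.

(** A redundant cell and its collapsible partner are given the same coordinate,
    so the face that matches them must not move it.  This is where
    guardedness enters. *)
Hypothesis coord_imap : forall n a (t : L n), red S n t ->
  coord P (face (imap S t) (pair_at P a (cmap S t))) = a.

Definition lift_scheme_of : collapsing_scheme K.
Proof.
apply: (@CollapsingScheme K lift_data) => [n|n|n|n||n x rx|n|n].
- apply/seteqP; split=> x.
    by move=> ?; apply/(base_cells P); rewrite -(scheme_cover S).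
  by move/(base_cells P); rewrite -(scheme_cover S).
- by rewrite -preimage_setI scheme_ess_col preimage_set0.
- by rewrite -preimage_setI scheme_ess_red preimage_set0.
- by rewrite -preimage_setI scheme_col_red preimage_set0.
- by rewrite /= scheme_col0 preimage_set0.
- apply: twisted_product_inj; first by rewrite coord_imap.
  by rewrite base_face base_pair; exact: scheme_face.
- have [cfun cinj csurj] := scheme_bij S n; split.
  + by move=> x rx /=; rewrite base_pair; apply: cfun.
  + move=> x y /set_mem rx /set_mem ry /= e; apply: twisted_product_inj.
      by have := congr1 (coord P (n := n.+1)) e; rewrite !coord_pair.
    apply: cinj; rewrite ?inE //.
    by have := congr1 (base P (n := n.+1)) e; rewrite !base_pair.
  + move=> y /csurj[t rt e]; exists (pair_at P (coord P y) t).
      by rewrite /= base_pair.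
    by rewrite /= coord_pair base_pair e pair_atK.
- case=> u hu; apply: (scheme_wf (c := S) (n := n)).
  by exists (fun k => base P (u k)) => k; apply: base_prec.
Defined.

Lemma lift_scheme_equivariant : equivariant lift_scheme_of.
Proof.
split=> [n m|n m x|n m x _||n m x _].
- by split=> i x; [exact: act_face | exact: act_degen].
- split; last by rewrite /= base_act.
  by split=> /(base_cells P) cx; apply/(base_cells P); move: cx; rewrite base_act.
- by rewrite /= base_act coord_act act_pair.
- have cellsE n : cells K n = base P (n := n) @^-1` cells L n.
    by apply/seteqP; split=> x /(base_cells P).
  have setIE n (A : set (L n)) : A `<=` cells L n ->
      base P (n := n) @^-1` A `&` unit_section (cells L n) = unit_section A.
    move=> sA; apply/seteqP; split=> x; first by case=> Ax [_ x1].
    by case=> Ax x1; split=> //; split=> //; apply: sA.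
  (* The collapsible partner of [x] has the same coordinate as [x], so it is in
     the basis exactly when [x] is. *)
  exists (fun n => unit_section (cells L n)); split=> [n|n x rx].
    have cov := scheme_cover S n.
    split; last 3 first.
    + by rewrite setIE; [exact: unit_section_basis | rewrite -cov => t; left; left].
    + by rewrite setIE; [exact: unit_section_basis | rewrite -cov => t; right].
    + by rewrite setIE; [exact: unit_section_basis | rewrite -cov => t; left; right].
    + by move=> x [+ _]; rewrite -cov => -[[]|]; [left; left | right | left; right].
    + by rewrite cellsE; exact: unit_section_basis.
  have cx : cells L n (base P x) by rewrite -(scheme_cover S); right.
  have [cfun _ _] := scheme_bij S n.
  have colc : col S n.+1 (cmap S (base P x)) by apply: cfun.
  have cc : cells L n.+1 (cmap S (base P x)).
    by rewrite -(scheme_cover S); left; right.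
  rewrite /setI /unit_section /= coord_pair base_pair.
  by split=> -[_ [_ x1]].
- by rewrite !height_lift base_act.
Qed.

Theorem lift_scheme : exists2 T : collapsing_scheme K, equivariant T &
  forall n, free_of_rank (@act N K n) (ess T n) (ess S n).
Proof.
exists lift_scheme_of; first exact: lift_scheme_equivariant.
move=> n; exists (unit_section (ess S n)); first exact: unit_section_basis.
exact: unit_section_card.
Qed.

End Lift.

Section CayleyNerves.
Variable M : monoidType.

Definition ER_twisted : twisted_product (ER M) (BM M).
Proof.
apply: (@TwistedProduct M (ER M) (BM M) (fun _ x => x.2) (fun _ x => x.1)
  (fun _ a t => (a, t))) => //.
- by move=> n [].
- by move=> n x; exact: ER_cells.
Defined.

Definition EL_twisted : twisted_product (EL M) (BM M).
Proof.
apply: (@TwistedProduct (opp_monoid M) (EL M) (BM M)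
  (fun _ x => x.1) (fun _ x => x.2) (fun _ a t => (t, a))) => //.
- by move=> n [].
- by move=> n x; exact: EL_cells.
Defined.

Definition ELR_twisted : twisted_product (ELR M) (BM M).
Proof.
apply: (@TwistedProduct (M * opp_monoid M)%type (ELR M) (BM M)
  (fun _ x => x.1.2) (fun _ x => (x.1.1, x.2))
  (fun _ a t => (a.1, t, a.2))) => //.
- by move=> n [[]].
- by move=> n [].
- by move=> n j [[]].
- by move=> n x; exact: ELR_cells.
Defined.

Lemma lead_face_inner n (j : 'I_n.+2) m (t : n.+1.-tuple M) :
  j <> ord0 -> lead_face j m t = m.
Proof. by rewrite /lead_face; case: eqP. Qed.

Lemma trail_face_inner n (j : 'I_n.+2) (t : n.+1.-tuple M) s :
  j <> ord_max -> trail_face j t s = s.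
Proof. by rewrite /trail_face; case: eqP. Qed.

End CayleyNerves.

Theorem theorem10p2 (M : monoidType) (S : collapsing_scheme (BM M)) :
  (left_guarded S ->
     exists2 T : collapsing_scheme (ER M), equivariant T &
       forall n, free_of_rank (@act M (ER M) n) (ess T n) (ess S n)) /\
  (right_guarded S ->
     exists2 T : collapsing_scheme (EL M), equivariant T &
       forall n,
         free_of_rank (@act (opp_monoid M) (EL M) n) (ess T n) (ess S n)) /\
  (guarded S ->
     exists2 T : collapsing_scheme (ELR M), equivariant T &
       forall n,
         free_of_rank (@act (M * opp_monoid M)%type (ELR M) n)
           (ess T n) (ess S n)).
Proof.
split; [|split].
- move=> gl; apply: (lift_scheme (P := ER_twisted M)) => n a t /gl i0.
  exact: lead_face_inner.
- move=> gr; apply: (lift_scheme (P := EL_twisted M)) => n a t /gr imax.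
  exact: (@trail_face_inner M).
- case=> gl gr; apply: (lift_scheme (P := ELR_twisted M)) => n [a b] t rt /=.
  by rewrite lead_face_inner ?trail_face_inner //; [exact: gr | exact: gl].
Qed.
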